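(* Let $G=(V,E)$ and the algorithm be as described in the context. In any stable configuration, the set $M=\{(i,j)\in E : p_i=j,\ p_j=i,\ m_i=m_j=\text{true}\}$ is a maximal matching of $G$, i.e. no two edges of $M$ share an endpoint, and no edge of $E\setminus M$ can be added to $M$ while keeping this property.
   Context: Let $G=(V,E)$ be a finite simple undirected graph; each node is a process and $N(i)$ denotes the set of neighbours of $i$. Each process has an identifier from a totally ordered set; identifiers of any two distinct processes at distance at most $2$ are distinct, and comparisons such as $j>i$ between processes are comparisons of their identifiers. Each process $i$ holds variables $m_i\in\{\text{true},\text{false}\}$ and $p_i\in\{null\}\cup N(i)$; a configuration is an assignment of values to all these variables. Define the predicate $PRmarried(i)\equiv \exists j\in N(i): (p_i=j \text{ and } p_j=i)$. The algorithm consists of the following four guarded rules for each process $i$ (a rule is enabled at $i$ if its guard holds): Update: if $m_i\neq PRmarried(i)$ then $m_i:=PRmarried(i)$. Marriage: if $m_i=PRmarried(i)$ and $p_i=null$ and there is $j\in N(i)$ with $p_j=i$, then $p_i:=j$ (for such a $j$). Seduction: if $m_i=PRmarried(i)$ and $p_i=null$ and $p_k\neq i$ for all $k\in N(i)$ and there is $j\in N(i)$ with $p_j=null$, $j>i$ and $m_j=\text{false}$, then $p_i:=\max\{j\in N(i): p_j=null,\ j>i,\ m_j=\text{false}\}$. Abandonment: if $m_i=PRmarried(i)$ and $p_i=j\neq null$ and $p_j\neq i$ and ($m_j=\text{true}$ or $j\le i$), then $p_i:=null$. A process is eligible if some rule is enabled at it. A configuration is stable if no process is eligible. *)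

(* Defs.v *)
From mathcomp Require Import all_boot all_order.

Set Implicit Arguments.
Unset Strict Implicit.
Unset Printing Implicit Defensive.

Record sgraph := SGraph {
  vertex :> finType;
  adj : rel vertex;
  adj_sym : symmetric adj;
  adj_irrefl : irreflexive adj
}.

Definition nbr (G : sgraph) (i : G) : {set G} := [set j | adj i j].

Definition edges (G : sgraph) : {set {set G}} :=
  [set [set i; j] | i in [set: G], j in nbr i].

Definition dist_le (G : sgraph) (k : nat) (i j : G) : Prop :=
  exists s : seq G, [/\ path (@adj G) i s, last i s = j & size s <= k].

Definition distinct_ids_at_dist2 (G : sgraph) (disp : Order.disp_t)
    (ID : orderType disp) (id : G -> ID) : Prop :=
  forall i j : G, i != j -> dist_le 2 i j -> id i != id j.

(* [None] stands for the value null. *)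
Record config (G : sgraph) := Config {
  mvar : G -> bool;
  pvar : G -> option G;
  pvar_nbr : forall i j : G, pvar i = Some j -> j \in nbr i
}.

Definition PRmarried (G : sgraph) (c : config G) (i : G) : bool :=
  [exists j in nbr i, (pvar c i == Some j) && (pvar c j == Some i)].

Inductive rule := Update | Marriage | Seduction | Abandonment.

Definition candidates (G : sgraph) (disp : Order.disp_t) (ID : orderType disp)
    (id : G -> ID) (c : config G) (i : G) : {set G} :=
  [set j in nbr i |
    [&& pvar c j == None, (id i < id j)%O & mvar c j == false]].

Definition guard (G : sgraph) (disp : Order.disp_t) (ID : orderType disp)
    (id : G -> ID) (c : config G) (r : rule) (i : G) : bool :=
  match r with
  | Update => mvar c i != PRmarried c i
  | Marriage =>
      [&& mvar c i == PRmarried c i, pvar c i == None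
        & [exists j in nbr i, pvar c j == Some i]]
  | Seduction =>
      [&& mvar c i == PRmarried c i, pvar c i == None,
          [forall k in nbr i, pvar c k != Some i]
        & [exists j, j \in candidates id c i]]
  | Abandonment =>
      (mvar c i == PRmarried c i) &&
      (if pvar c i is Some j then
         (pvar c j != Some i) && ((mvar c j == true) || (id j <= id i)%O)
       else false)
  end.

(* [command id c r i m' p']: executing [r] at [i] in [c] may give [i] the new
   values [m'] and [p'].  The Marriage rule is nondeterministic; the maximum in
   Seduction is unique because two neighbours of [i] are at distance at most 2.
   Stability depends on the guards only. *)
Definition command (G : sgraph) (disp : Order.disp_t) (ID : orderType disp)
    (id : G -> ID) (c : config G) (r : rule) (i : G)
    (m' : bool) (p' : option G) : Prop :=
  match r with
  | Update => m' = PRmarried c i /\ p' = pvar c i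
  | Marriage =>
      m' = mvar c i /\
      exists j : G, [/\ j \in nbr i, pvar c j = Some i & p' = Some j]
  | Seduction =>
      m' = mvar c i /\
      exists j : G,
        [/\ j \in candidates id c i,
            (forall k : G, k \in candidates id c i -> (id k <= id j)%O)
          & p' = Some j]
  | Abandonment => m' = mvar c i /\ p' = None
  end.

Definition eligible (G : sgraph) (disp : Order.disp_t) (ID : orderType disp)
    (id : G -> ID) (c : config G) (i : G) : Prop :=
  exists r : rule, guard id c r i.

Definition stable (G : sgraph) (disp : Order.disp_t) (ID : orderType disp)
    (id : G -> ID) (c : config G) : Prop :=
  forall i : G, ~ eligible id c i.

Definition matched_edges (G : sgraph) (c : config G) : {set {set G}} :=
  [set [set i; j] | i in [set: G], j in nbr i &
    [&& pvar c i == Some j, pvar c j == Some i,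
        mvar c i == true & mvar c j == true]].

Definition matching (G : sgraph) (M : {set {set G}}) : Prop :=
  M \subset edges G /\
  (forall A B : {set G}, A \in M -> B \in M -> A != B -> [disjoint A & B]).

Definition maximal_matching (G : sgraph) (M : {set {set G}}) : Prop :=
  matching M /\
  (forall A : {set G}, A \in edges G :\: M -> ~ matching (A |: M)).

(* Main.v *)
(** In a stable configuration no process points to a neighbour that does not
    point back: such an [i], pointing to [j], cannot abandon, so [j] is unmarried
    and has a larger identifier, and as [j] cannot marry [i] it points elsewhere,
    again without being pointed back to.  Identifiers would then increase forever.
    So every process is either single with a null pointer, or married; two
    adjacent single processes are excluded by the Seduction rule. *)

Require Import Defs.
From mathcomp Require Import all_boot all_order.

Import Order.TTheory.

(** Neighbours are joined by a path of length one, and irreflexivity of [adj] makes them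
    distinct. *)
Lemma adj_id_neq {G : sgraph} {disp : Order.disp_t} {ID : orderType disp}
    {id : G -> ID} (hid : distinct_ids_at_dist2 id) (i j : G) :
  adj i j -> id i != id j.
Proof.
move=> aij; apply: hid; last by exists [:: j]; split; rewrite //= aij.
by apply: contraTneq aij => ->; rewrite adj_irrefl.
Qed.

Lemma stable_guardF {G : sgraph} {disp : Order.disp_t} {ID : orderType disp}
    {id : G -> ID} {c : config G} (hc : stable id c) (r : rule) (i : G) :
  guard id c r i = false.
Proof. by apply/negP => g; apply: (hc i); exists r. Qed.

Lemma stable_mvar {G : sgraph} {disp : Order.disp_t} {ID : orderType disp}
    {id : G -> ID} {c : config G} (hc : stable id c) (i : G) :
  mvar c i = PRmarried c i.
Proof. exact/eqP/negPn/(negbT (stable_guardF hc Update i)). Qed.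

Lemma PRmarriedP {G : sgraph} (c : config G) (i : G) :
  reflect (exists j, pvar c i = Some j /\ pvar c j = Some i) (PRmarried c i).
Proof.
apply: (iffP exists_inP) => [[j _ /andP[/eqP pi /eqP pj]]|[j [pi pj]]].
  by exists j.
by exists j; [exact: pvar_nbr pi | rewrite pi pj !eqxx].
Qed.

Lemma stable_unrequited {G : sgraph} {disp : Order.disp_t} {ID : orderType disp}
    {id : G -> ID} {c : config G} (hc : stable id c) (i j : G) :
    pvar c i = Some j -> pvar c j != Some i ->
  (id i < id j)%O /\ exists2 k, pvar c j = Some k & pvar c k != Some j.
Proof.
move=> pi pj.
have := stable_guardF hc Abandonment i.
rewrite /= (stable_mvar hc i) eqxx pi pj /=.
move/negbT; rewrite negb_or -ltNge => /andP[mjF ltij]; split=> //.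
(* If [k] pointed back, [j] would be married and [mvar c j] true, against [mjF]. If the pointer of
   [j] were null, Marriage would be enabled at [j] through [i]. *)
case Epj: (pvar c j) => [k|].
  exists k => //; apply: contra mjF => /eqP pk.
  by rewrite (stable_mvar hc); apply/eqP/PRmarriedP; exists k.
have := stable_guardF hc Marriage j.
rewrite /= (stable_mvar hc j) eqxx Epj eqxx /= => /exists_inP[].
exists i; last exact/eqP.
by have := pvar_nbr pi; rewrite !inE adj_sym.
Qed.

Lemma stable_pvar_sym {G : sgraph} {disp : Order.disp_t} {ID : orderType disp}
    {id : G -> ID} {c : config G} (hc : stable id c) (i j : G) :
  pvar c i = Some j -> pvar c j = Some i.
Proof.
move=> pi; apply/eqP/negPn/negP => pj.
pose bad x := if pvar c x is Some y then pvar c y != Some x else false.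
have bad_i : bad i by rewrite /bad pi.
(* Finiteness of [G] rules out the endless increase: a bad process with maximal identifier points to
   a bad one with a strictly larger identifier. *)
case: (arg_maxP id bad_i) => x; rewrite {1}/bad.
case px: (pvar c x) => [y|] // py maxx.
have [ltxy [z pz zy]] := stable_unrequited hc x y px py.
by have := maxx y; rewrite /bad pz => /(_ zy); rewrite /= leNgt ltxy.
Qed.

(** The pointer of either endpoint determines the whole edge, so two matched edges with a common
    endpoint coincide. *)
Lemma mem_matched_edges {G : sgraph} {c : config G} {A : {set G}} {x : G} :
    A \in matched_edges c -> x \in A ->
  exists2 y, pvar c x = Some y & A = [set x; y].
Proof.
case/imset2P => i j _; rewrite inE => /and5P[_ /eqP pi /eqP pj _ _] ->.
by rewrite !inE => /orP[] /eqP ->; [exists j | exists i; rewrite // setUC].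
Qed.

Lemma matching_matched_edges {G : sgraph} (c : config G) :
  matching (matched_edges c).
Proof.
split.
  apply/subsetP => A /imset2P[i j _]; rewrite inE => /andP[ij _] ->.
  exact: imset2_f.
move=> A B MA MB; apply: contraR => /pred0Pn[x /andP[xA xB]].
have [y px ->] := mem_matched_edges MA xA.
have [z] := mem_matched_edges MB xB.
by rewrite px => -[<-] ->.
Qed.

Lemma stable_married_edge {G : sgraph} {disp : Order.disp_t} {ID : orderType disp}
    {id : G -> ID} {c : config G} (hc : stable id c) (i k : G) :
  pvar c i = Some k -> [set i; k] \in matched_edges c.
Proof.
move=> pi; have pk := stable_pvar_sym hc i k pi.
(* As Update is disabled, the conditions on [mvar] reduce to both ends being married. *)
apply: imset2_f => //; rewrite inE (pvar_nbr pi) pi pk !eqxx !(stable_mvar hc) /=.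
apply/andP; split; apply/eqP/PRmarriedP; by [exists k | exists i].
Qed.

Lemma stable_adj_pointing {G : sgraph} {disp : Order.disp_t} {ID : orderType disp}
    {id : G -> ID} (hid : distinct_ids_at_dist2 id)
    {c : config G} (hc : stable id c) (i j : G) :
  adj i j -> (exists k, pvar c i = Some k) \/ (exists k, pvar c j = Some k).
Proof.
move=> aij.
case pi: (pvar c i) => [k|]; first by left; exists k.
case pj: (pvar c j) => [k|]; first by right; exists k.
(* Adjacent identifiers differ, so the smaller of two single neighbours can seduce. *)
suff seduce (x y : G) : adj x y -> pvar c x = None -> pvar c y = None ->
    (id x < id y)%O -> False.
  have := adj_id_neq hid i j aij; rewrite neq_lt => /orP[].
    by move/(seduce i j aij pi pj).
  by rewrite adj_sym in aij; move/(seduce j i aij pj pi).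
move=> axy px py ltxy; have /negP[] := negbT (stable_guardF hc Seduction x).
rewrite /= (stable_mvar hc x) px !eqxx /=; apply/andP; split.
  (* A process pointing to [x] would be pointed back to, but [x] has a null pointer. *)
  apply/forall_inP => k _; apply/eqP => pk.
  by have := stable_pvar_sym hc k x pk; rewrite px.
apply/existsP; exists y; rewrite !inE axy py eqxx ltxy (stable_mvar hc) /=.
by apply/eqP/negbTE/PRmarriedP => -[k []]; rewrite py.
Qed.

Theorem theorem1 (G : sgraph) (disp : Order.disp_t) (ID : orderType disp)
    (id : G -> ID) (hid : distinct_ids_at_dist2 id)
    (c : config G) (hc : stable id c) :
  maximal_matching (matched_edges c).
Proof.
split=> [|A]; first exact: matching_matched_edges.
rewrite inE => /andP[nMA /imset2P[i j _]]; rewrite inE => aij EA [_ disjM].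
(* Some endpoint [x] of the added edge has a non-null pointer, so it already lies on a matched edge,
   which meets [A] at [x]. *)
have [x [k [xA px]]] : exists x k, x \in A /\ pvar c x = Some k.
  have [[k p]|[k p]] := stable_adj_pointing hid hc i j aij.
    by exists i, k; rewrite EA !inE eqxx.
  by exists j, k; rewrite EA !inE eqxx orbT.
have Mxk := stable_married_edge hc x k px.
have AneB : A != [set x; k] by apply: contraNneq nMA => ->.
have := disjM A [set x; k] (setU11 _ _) (setU1r _ Mxk) AneB.
by move/disjoint_setI0/setP/(_ x); rewrite !inE xA eqxx.
Qed.
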